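(* For every digraph $D$, ${\rm ndi}(D)\le 2\Delta^*(D)$.
   Context: All digraphs are finite, without loops and without multiple arcs (opposite arcs allowed). For a vertex $u$, $d_D^+(u)$, $d_D^-(u)$ denote outdegree and indegree; $\Delta^*(D)=\max\{\max_u d_D^+(u),\max_u d_D^-(u)\}$. A (proper) $k$-arc-colouring of $D$ is a map $\gamma$ from $A(D)$ to a set of $k$ colours such that arcs with the same head get distinct colours and arcs with the same tail get distinct colours. $S_\gamma^+(u)$, $S_\gamma^-(u)$ are the sets of colours on arcs with tail $u$, resp. head $u$. $\gamma$ is neighbour-distinguishing if for every arc $uv$, $(S_\gamma^+(u),S_\gamma^-(u))\neq(S_\gamma^+(v),S_\gamma^-(v))$ as ordered pairs. ${\rm ndi}(D)$ is the minimum number of colours of a neighbour-distinguishing arc-colouring of $D$. *)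

(* Defs.v *)
From mathcomp Require Import all_boot.

Set Implicit Arguments.
Unset Strict Implicit.
Unset Printing Implicit Defensive.

Record digraph := Digraph {
  vertex :> finType;
  adj : rel vertex;
  adj_irr : irreflexive adj
}.

(* Colourings have exactly this type as domain, so an arcless digraph has a
   colouring with zero colours. *)
Definition arc (D : digraph) : finType := {a : D * D | adj a.1 a.2}.

Section Digraph.
Variable D : digraph.

Definition tail (a : arc D) : D := (val a).1.
Definition head (a : arc D) : D := (val a).2.

Definition outdeg (u : D) : nat := #|[set a : arc D | tail a == u]|.
Definition indeg (u : D) : nat := #|[set a : arc D | head a == u]|.

Definition max_deg : nat :=
  maxn (\max_(u : D) outdeg u) (\max_(u : D) indeg u).

Section Colouring.
Variables (k : nat) (g : {ffun arc D -> 'I_k}).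

Definition arc_colouring : bool :=
  [forall a : arc D, forall b : arc D,
     (a != b) && ((head a == head b) || (tail a == tail b)) ==> (g a != g b)].

Definition Sout (u : D) : {set 'I_k} := [set g a | a : arc D & tail a == u].
Definition Sin (u : D) : {set 'I_k} := [set g a | a : arc D & head a == u].

Definition neighbour_distinguishing : bool :=
  [forall a : arc D,
     (Sout (tail a), Sin (tail a)) != (Sout (head a), Sin (head a))].

End Colouring.

Definition nd_colourable (k : nat) : bool :=
  [exists g : {ffun arc D -> 'I_k},
     arc_colouring g && neighbour_distinguishing g].

(* Giving all arcs distinct colours works, so the minimum below exists. *)
Lemma nd_colourable_exists : exists k, nd_colourable k.
Proof.
exists #|arc D|; apply/existsP; exists [ffun a => enum_rank a].
apply/andP; split.
  apply/forallP=> a; apply/forallP=> b; apply/implyP=> /andP[neq_ab _].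
  by rewrite !ffunE (inj_eq enum_rank_inj).
apply/forallP=> a; apply/eqP=> -[eqS _].
have : enum_rank a \in Sout [ffun a => enum_rank a] (tail a).
  by apply/imsetP; exists a; rewrite ?inE ?ffunE.
rewrite eqS => /imsetP[b]; rewrite inE ffunE => /eqP tb /enum_rank_inj ab.
have := valP a; rewrite -ab in tb; rewrite -/(tail a) -/(head a) tb.
by rewrite adj_irr.
Qed.

Definition ndi : nat := ex_minn nd_colourable_exists.

End Digraph.

(* Main.v *)
Require Import Defs.
From mathcomp Require Import all_boot.

Set Implicit Arguments.
Unset Strict Implicit.
Unset Printing Implicit Defensive.

(** By König's edge-colouring theorem, applied to the bipartite graph with an
    edge from the out-copy of [u] to the in-copy of [v] for each arc [uv], the
    arcs split into [max_deg D] classes, each inducing vertex-disjoint directed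
    paths and cycles.  Split each class into two colours so that no three
    consecutive arcs of a path or cycle agree.  If an arc [uv] had
    [S(u) = S(v)], the colour of [uv] would also appear on an arc of the same
    class leaving [v] and on one entering [u], giving three such arcs. *)

Lemma exists_free_colour (E : finType) (c : E -> nat) (A : {set E}) (k : nat) :
  #|A| < k -> exists2 a, a < k & forall e, e \in A -> c e != a.
Proof.
move=> ltAk; pose s := [seq c e | e in A].
have [/allP sub|/allPn[a]] := boolP (all (mem s) (iota 0 k)).
  have := uniq_leq_size (iota_uniq 0 k) sub.
  by rewrite size_iota size_map -cardE leqNgt ltAk.
rewrite mem_iota add0n => /andP[_ ltak] as'; exists a => // e eA.
by apply: contraNneq as' => <-; apply: image_f.
Qed.

(** [E] is the edge set of a bipartite multigraph with end maps [l] and [r]. Restricting to [S]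
    allows induction on the edges. *)
Definition proper_on (E L R : finType) (l : E -> L) (r : E -> R)
    (S : {set E}) (c : E -> nat) : Prop :=
  {in S &, forall e f, l e = l f \/ r e = r f -> c e = c f -> e = f}.

(* The Kempe chain leaving [u] along [b] is followed forwards only.  It is
   closed backwards as well: every edge but the first has its predecessor on
   the chain, and the first has none because [a] is missing at [u].  It never
   arrives at [v], since it enters right vertices along colour [b]. *)
Lemma kempe_swap (E L R : finType) (l : E -> L) (r : E -> R) (S : {set E})
    (k : nat) (c : E -> nat) (u : L) (v : R) (a b : nat) :
  a < k -> b < k -> proper_on l r S c -> {in S, forall e, c e < k} ->
  {in S, forall e, l e = u -> c e != a} ->
  {in S, forall e, r e = v -> c e != b} ->
  exists c' : E -> nat,
    [/\ proper_on l r S c', {in S, forall e, c' e < k}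
      & {in S, forall e, l e = u \/ r e = v -> c' e != b}].
Proof.
move=> ltak ltbk c_proper c_lt u_free v_free.
have [eq_ab|neq_ab] := eqVneq a b.
  exists c; split=> // e eS [] ?; last exact: v_free.
  by rewrite -eq_ab; apply: u_free.
(* The chain crosses [b]-edges from left to right and [a]-edges from right to left. *)
pose nxt e f := [&& e \in S, f \in S &
  [&& c e == b, c f == a & r e == r f] || [&& c e == a, c f == b & l e == l f]].
pose start e := [&& e \in S, l e == u & c e == b].
pose K := [pred f | [exists e, start e && connect nxt e f]].
have K_start e : start e -> e \in K.
  by move=> se; apply/existsP; exists e; rewrite se connect0.
have K_next e f : e \in K -> nxt e f -> f \in K.
  move=> /existsP[e0 /andP[se0 e0e]] ef; apply/existsP; exists e0.
  by rewrite se0 (connect_trans e0e (connect1 ef)).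
have K_prev f : f \in K -> start f \/ exists2 e, e \in K & nxt e f.
  move=> /existsP[e0 /andP[se0 /connectP[p]]].
  case/lastP: p => [_ -> | p x]; first by left.
  rewrite rcons_path last_rcons => /andP[e0p px] ->; right.
  exists (last e0 p) => //; apply/existsP; exists e0; rewrite se0.
  by apply/connectP; exists p.
have K_ab f : f \in K -> c f = a \/ c f = b.
  move=> /K_prev[/and3P[_ _ /eqP]|[e _ /and3P[_ _ /orP[]/and3P[_ /eqP]]]];
    by [left|right].
have K_closed e f : e \in K -> e \in S -> f \in S -> l e = l f \/ r e = r f ->
    c f = a \/ c f = b -> c e != c f -> f \in K.
  move=> eK eS fS ef cf neq_ef.
  have [ea|eb] := K_ab _ eK.
    have fb : c f = b by case: cf neq_ef => // ->; rewrite ea eqxx.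
    case: ef => [lef|ref].
      by apply: K_next eK _; rewrite /nxt eS fS ea fb lef !eqxx orbT.
    (* [f] meets [e] at the end where the chain entered [e], so properness makes [f] the predecessor
       of [e]. *)
    case: (K_prev _ eK) => [/and3P[_ _]|[g gK /and3P[gS _]]].
      by rewrite ea (negPf neq_ab).
    rewrite ea (negPf neq_ab) !andbF orbF => /and3P[/eqP gb _ /eqP gr].
    suff -> : f = g by [].
    by apply: c_proper => //; [right; rewrite gr ref|rewrite gb].
  have fa : c f = a by case: cf neq_ef => // ->; rewrite eb eqxx.
  case: ef => [lef|ref]; last first.
    by apply: K_next eK _; rewrite /nxt eS fS eb fa ref !eqxx.
  case: (K_prev _ eK) => [/and3P[_ /eqP eu _]|[g gK /and3P[gS _]]].
    by have := u_free f fS; rewrite -lef eu fa eqxx => /(_ erefl).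
  rewrite eb [b == a]eq_sym (negPf neq_ab) andbF /= => /and3P[/eqP ga _ /eqP gl].
  suff -> : f = g by [].
  by apply: c_proper => //; [left; rewrite gl lef|rewrite ga].
pose sw x := if x == a then b else if x == b then a else x.
have swa : sw a = b by rewrite /sw eqxx.
have swb : sw b = a by rewrite /sw eqxx eq_sym (negPf neq_ab).
have sw_inj : injective sw.
  apply: (can_inj (g := sw)) => x; rewrite {2}/sw.
  by case: eqP => [->//|xa]; case: eqP => [->//|xb]; rewrite /sw; do 2?case: eqP.
pose c' e := if e \in K then sw (c e) else c e.
(* A clash would make [f] an edge of the other colour adjacent to [e], hence on the chain. *)
have mixed e f : e \in S -> f \in S -> l e = l f \/ r e = r f ->
    e \in K -> f \notin K -> sw (c e) != c f.
  move=> eS fS ef eK; apply: contraNneq => ce.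
  apply: (K_closed e) => //.
    by rewrite -ce; case: (K_ab _ eK) => ->; rewrite ?swa ?swb; auto.
  rewrite -ce; case: (K_ab _ eK) => ->; rewrite ?swa ?swb //.
  by rewrite eq_sym.
exists c'; split=> [e f eS fS ef|e eS|e eS uv].
- rewrite /c'; case: ifPn => eK; case: ifPn => fK.
  + by move/sw_inj; apply: c_proper.
  + by move/eqP; rewrite (negPf (mixed _ _ eS fS ef eK fK)).
  + have fe : l f = l e \/ r f = r e by case: ef; auto.
    by move/esym/eqP; rewrite (negPf (mixed _ _ fS eS fe fK eK)).
  + exact: c_proper.
- rewrite /c' /sw; case: ifP => _; last exact: c_lt.
  by do 2![case: ifP => // _]; apply: c_lt.
(* On the chain only [a]-edges become [b]: none lies at [u], and one at [v] would have a
   [b]-coloured predecessor there. Off the chain, a [b]-edge at [u] would have started it. *)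
rewrite /c'; case: ifPn => eK.
  case: (K_ab _ eK) => ce; last by rewrite ce swb.
  case: uv => [eu|ev]; first by have := u_free e eS eu; rewrite ce eqxx.
  case: (K_prev _ eK) => [/and3P[_ _]|[g gK /and3P[gS _]]].
    by rewrite ce (negPf neq_ab).
  rewrite ce (negPf neq_ab) !andbF orbF => /and3P[gb _ /eqP gr].
  by have := v_free g gS; rewrite gr gb => /(_ ev).
case: uv => [eu|]; last exact: v_free.
apply: contraNneq eK => ce; apply: K_start.
by rewrite /start eS eu ce !eqxx.
Qed.

(** Induction on [#|S|]: remove [e0] and colour the rest. Some [a] is then missing at the left end
    of [e0] and some [b] at the right end; a Kempe swap frees [b] at both, and [e0] receives it. *)
Lemma konig_edge_colouring (E L R : finType) (l : E -> L) (r : E -> R)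
    (k : nat) (S : {set E}) :
  (forall x, #|[set e in S | l e == x]| <= k) ->
  (forall y, #|[set e in S | r e == y]| <= k) ->
  exists2 c : E -> nat, proper_on l r S c & {in S, forall e, c e < k}.
Proof.
have [n] := ubnP #|S|; elim: n S => // n IHn S ltSn degl degr.
have [->|[e0 e0S]] := set_0Vmem S.
  by exists (fun=> 0) => e; rewrite inE.
pose S' := S :\ e0.
have S'S e : e \in S' -> e \in S by rewrite inE => /andP[].
have deg_lt (T : finType) (h : E -> T) : #|[set e in S | h e == h e0]| <= k ->
    #|[set e in S' | h e == h e0]| < k.
  apply: leq_trans; apply: proper_card; apply/properP; split.
    by apply/subsetP=> e; rewrite !inE => /andP[/andP[_ ->] ->].
  by exists e0; rewrite !inE ?e0S eqxx.
have deg_le (T : finType) (h : E -> T) x : #|[set e in S | h e == x]| <= k ->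
    #|[set e in S' | h e == x]| <= k.
  apply: leq_trans; apply: subset_leq_card.
  by apply/subsetP=> e; rewrite !inE => /andP[/andP[_ ->] ->].
have ltS'n : #|S'| < n by move: ltSn; rewrite (cardsD1 e0) e0S.
have [c c_proper c_lt] := IHn S' ltS'n
  (fun x => deg_le _ l x (degl x)) (fun y => deg_le _ r y (degr y)).
have [a ltak a_free] := exists_free_colour c (deg_lt _ l (degl _)).
have [b ltbk b_free] := exists_free_colour c (deg_lt _ r (degr _)).
have u_free : {in S', forall e, l e = l e0 -> c e != a}.
  by move=> e eS' le; apply: a_free; rewrite inE eS' le eqxx.
have v_free : {in S', forall e, r e = r e0 -> c e != b}.
  by move=> e eS' re; apply: b_free; rewrite inE eS' re eqxx.
have [c' [c'_proper c'_lt c'_free]] :=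
  kempe_swap ltak ltbk c_proper c_lt u_free v_free.
exists (fun e => if e == e0 then b else c' e) => [e f eS fS ef|e eS]; last first.
  by case: eqP => // /eqP ne; apply: c'_lt; rewrite !inE ne.
case: eqVneq => [ee0|ne]; case: eqVneq => [fe0|nf].
- by rewrite ee0 fe0.
- move/esym/eqP; rewrite (negPf (c'_free _ _ _)) //; first by rewrite !inE nf.
  by rewrite -ee0; case: ef; auto.
- move/eqP; rewrite (negPf (c'_free _ _ _)) //; first by rewrite !inE ne.
  by rewrite -fe0; case: ef; auto.
- by apply: c'_proper => //; rewrite !inE ?ne ?nf.
Qed.

(* Take [h] with the fewest monochromatic pairs: flipping the middle of a
   monochromatic triple would remove two of them and create none. *)
Lemma two_colouring_no_mono_triple (E : finType) (s : rel E) :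
  irreflexive s ->
  (forall x y z, s x y -> s x z -> y = z) ->
  (forall x y z, s x z -> s y z -> x = y) ->
  exists h : E -> bool, forall x y z, s x y -> s y z -> h x = h y -> h y <> h z.
Proof.
move=> s_irr s_fun s_inj.
pose mono (h : {ffun E -> bool}) :=
  [set p : E * E | s p.1 p.2 && (h p.1 == h p.2)].
case: (arg_minnP (P := predT) (fun h => #|mono h|) (i0 := [ffun=> true])) => //.
move=> h _ h_min; exists h => x y z sxy syz hxy hyz.
pose h' : {ffun E -> bool} := [ffun e => if e == y then ~~ h e else h e].
have := h_min h' isT; rewrite leqNgt => /negP[]; apply: proper_card.
have xy : (x == y) = false by apply: contraTF sxy => /eqP->; rewrite s_irr.
have zy : (z == y) = false by apply: contraTF syz => /eqP->; rewrite s_irr.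
apply/properP; split; last first.
  by exists (x, y); rewrite inE /= sxy ?hxy //= !ffunE eqxx xy hxy; case: (h y).
apply/subsetP=> -[p q]; rewrite !inE /= !ffunE => /andP[spq].
(* The flip affects only pairs containing [y], which are [(x, y)] and [(y, z)]; both were
   monochromatic and cease to be. *)
rewrite spq; case: (eqVneq p y) => [py|_]; case: (eqVneq q y) => [qy|_] //=.
- by move: spq; rewrite py qy s_irr.
- rewrite py in spq *.
  by rewrite -(s_fun _ _ _ syz spq) hyz; case: (h z).
rewrite qy in spq *.
by rewrite -(s_inj _ _ _ sxy spq) hxy; case: (h y).
Qed.

Lemma nd_colourable_double_max_deg (D : digraph) :
  nd_colourable D (2 * max_deg D).
Proof.
have degl (x : D) : #|[set e in [set: Defs.arc D] | tail e == x]| <= max_deg D.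
  rewrite (eq_card (B := [set e | tail e == x])) => [|e]; last by rewrite !inE.
  exact: leq_trans (leq_bigmax (F := @outdeg D) x) (leq_maxl _ _).
have degr (x : D) : #|[set e in [set: Defs.arc D] | Defs.head e == x]| <= max_deg D.
  rewrite (eq_card (B := [set e | Defs.head e == x])) => [|e]; last by rewrite !inE.
  exact: leq_trans (leq_bigmax (F := @indeg D) x) (leq_maxr _ _).
have [c c_proper c_lt] := konig_edge_colouring degl degr.
pose s (e f : Defs.arc D) := (Defs.head e == tail f) && (c e == c f).
have s_irr : irreflexive s.
  move=> e; apply/negP=> /andP[/eqP he _]; have := valP e.
  by rewrite /= -/(tail e) -/(Defs.head e) he adj_irr.
have s_fun x y z : s x y -> s x z -> y = z.
  move=> /andP[/eqP hy /eqP cy] /andP[/eqP hz /eqP cz].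
  by apply: c_proper; rewrite ?inE -?cy //; left; rewrite -hy.
have s_inj x y z : s x z -> s y z -> x = y.
  move=> /andP[/eqP hx /eqP cx] /andP[/eqP hy /eqP cy].
  by apply: c_proper; rewrite ?inE ?cx //; right; rewrite hx.
have [h h_triple] := two_colouring_no_mono_triple s_irr s_fun s_inj.
(* The pair of class [c e] and bit [h e] is coded as one number, decoded by [half] and [odd]. *)
have g_lt e : h e + (c e).*2 < 2 * max_deg D.
  have ce : c e < max_deg D by apply: c_lt; rewrite inE.
  rewrite mul2n; apply: leq_trans (_ : (c e).+1.*2 <= _); last by rewrite leq_double.
  by rewrite doubleS ltnS; case: (h e).
pose g : {ffun Defs.arc D -> 'I_(2 * max_deg D)} := [ffun e => Ordinal (g_lt e)].
have g_eq e f : g e = g f -> h e = h f /\ c e = c f.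
  rewrite !ffunE => /(congr1 val) /= gef; split.
    by have := congr1 odd gef; rewrite !oddD !odd_double !addbF !oddb.
  by have := congr1 half gef; rewrite !half_bit_double.
apply/existsP; exists g; apply/andP; split.
  apply/forallP=> e; apply/forallP=> f; apply/implyP=> /andP[nef hef].
  apply: contraNneq nef => /g_eq[_ cef]; apply/eqP.
  by apply: c_proper; rewrite ?inE //; case/orP: hef => /eqP; auto.
apply/forallP=> e; apply/eqP=> -[eq_out eq_in].
have : g e \in Sout g (tail e) by apply/imsetP; exists e; rewrite ?inE.
rewrite eq_out => /imsetP[f]; rewrite inE => /eqP tf /g_eq[hef cef].
have : g e \in Sin g (Defs.head e) by apply/imsetP; exists e; rewrite ?inE.
rewrite -eq_in => /imsetP[d]; rewrite inE => /eqP hd /g_eq[hed ced].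
(* Here [d = f] is possible, when [e] lies on a directed 2-cycle; the triple lemma covers this
   case. *)
by apply: (h_triple d e f) => //; rewrite /s ?hd ?tf -?ced -?cef !eqxx.
Qed.

Theorem theorem6 (D : digraph) : ndi D <= 2 * max_deg D.
Proof.
rewrite /ndi; case: ex_minnP => m _; apply.
exact: nd_colourable_double_max_deg.
Qed.
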